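(* (Pull-back formula.) If $\pi:\mathsf A\to\mathsf B$ is a homogeneous covering of discrete groupoids with finite homs, then for any integrable morphism $\varphi:\mathsf B\to V$ one has $$\int_{\mathcal A}\pi^*\varphi\,d\mu_{\mathcal A}=(\deg\pi)\int_{\mathcal B}\varphi\,d\mu_{\mathcal B},$$ where $\pi^*\varphi=\varphi\circ\pi$ and $\deg\pi$ is the constant degree of $\pi$.
   Context: A groupoid is a small category in which all morphisms are isomorphisms; it has finite homs if $\mathrm{Aut}\,x$ is finite for every object $x$. A discrete groupoid is a groupoid with the discrete topology. $\mathcal A$ denotes the set of isomorphism classes of objects of $\mathsf A$ (the coarse space), and similarly $\mathcal B$ for $\mathsf B$. The discrete measure on $\mathcal A$ is $\mu_{\mathcal A}([x])=1/|\mathrm{Aut}\,x|$. A functor $\pi:\mathsf A\to\mathsf B$ is a *covering* if for every morphism $f:y_1\to y_2$ in $\mathsf B$ and every object $x_1$ of $\mathsf A$ with $\pi(x_1)=y_1$ there is a unique morphism in $\mathsf A$ with source $x_1$ mapped by $\pi$ to $f$. It is *finite* if for every object $y$ of $\mathsf B$ the set $\{x\in\mathrm{Ob}(\mathsf A):\pi(x)=y\}$ is finite; the *degree* $\deg\pi(y)$ is the cardinality of this set (it depends only on the isomorphism class of $y$). A finite covering is *homogeneous* if its degree is constant. Integrals are defined for discrete groupoids with finite homs and graded objects, i.e. equipped with a decomposition $\mathsf A\simeq\coprod_{n\in\mathbb N}\mathsf A_n$, such that the set $\mathcal A_n$ of isomorphism classes of objects of $\mathsf A_n$ is finite for every $n$;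 the groupoids over which one integrates are understood to be of this kind. $V$ is a topological module over a topological commutative unital $\mathbb C$-algebra $R$, regarded as a groupoid with only identity morphisms. A morphism $\varphi:\mathsf A\to V$ is thus a map on objects constant on isomorphism classes. It is *integrable* if the series $\sum_{n=0}^\infty\big(\sum_{[x]\in\mathcal A_n}\varphi(x)/|\mathrm{Aut}\,x|\big)$ converges in $V$; one then writes $\int_{\mathcal A}\varphi\,d\mu_{\mathcal A}=\sum_{[x]\in\mathcal A}\varphi(x)/|\mathrm{Aut}\,x|$ for its sum.
   Formalization: The covering is additionally assumed to preserve the gradings of A and B (without this the formula fails, e.g. for the identity with a rearranged conditionally convergent series); the equality of integrals is stated for Hausdorff V, where the sum is unique. *)

(* Defs.v *)
From HB Require Import structures.
From mathcomp Require Import all_boot all_order all_algebra generic_quotient.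
From mathcomp Require Import finmap complex.
From mathcomp Require Import all_classical all_reals all_analysis.

Set Implicit Arguments.
Unset Strict Implicit.
Unset Printing Implicit Defensive.

Import GRing.Theory.
Local Open Scope quotient_scope.
Local Open Scope classical_set_scope.
Local Open Scope ring_scope.

Record category := Category {
  obj :> Type;
  hom : obj -> obj -> Type;
  idm : forall x, hom x x;
  compm : forall x y z, hom y z -> hom x y -> hom x z;
  compm_idl : forall x y (f : hom x y), compm (idm y) f = f;
  compm_idr : forall x y (f : hom x y), compm f (idm x) = f;
  compmA : forall x y z t (h : hom z t) (g : hom y z) (f : hom x y),
    compm h (compm g f) = compm (compm h g) f
}.

Definition is_iso (C : category) (x y : C) (f : hom x y) : Prop :=
  exists g : hom y x, compm g f = idm x /\ compm f g = idm y.

Definition isomorphic (C : category) (x y : C) : Prop :=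
  exists f : hom x y, is_iso f.

Record groupoid := Groupoid {
  gpd_cat :> category;
  gpd_iso : forall (x y : gpd_cat) (f : hom x y), is_iso f
}.

Record functor (C D : category) := Functor {
  fobj :> C -> D;
  fmor : forall x y, hom x y -> hom (fobj x) (fobj y);
  fmor_id : forall x, fmor (idm x) = idm (fobj x);
  fmor_comp : forall x y z (g : hom y z) (f : hom x y),
    fmor (compm g f) = compm (fmor g) (fmor f)
}.

Section FunctorComposition.
Variables (C D E : category) (G : functor D E) (F : functor C D).

Let fc_map x y (f : hom x y) : hom (G (F x)) (G (F y)) := fmor G (fmor F f).

Let fc_id x : fc_map (idm x) = idm (G (F x)).
Proof. by rewrite /fc_map !fmor_id. Qed.

Let fc_comp x y z (g : hom y z) (f : hom x y) :
  fc_map (compm g f) = compm (fc_map g) (fc_map f).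
Proof. by rewrite /fc_map !fmor_comp. Qed.

Definition fcomp : functor C E := Functor fc_id fc_comp.

End FunctorComposition.

(** The groupoid with object set [T] and only identity morphisms: there is a
    morphism from [x] to [y] exactly when [x = y]. A functor to [idgroupoid T]
    is a map on objects which is constant on isomorphism classes. *)
Section IdGroupoid.
Variable T : Type.

Let idg_comp (x y z : T) (g : y = z) (f : x = y) : x = z := etrans f g.

Definition idgroupoid_cat : category.
Proof.
refine (@Category T (fun x y => x = y) (fun x => erefl x) idg_comp _ _ _).
- by move=> x y f; case: y / f.
- by move=> x y f; case: y / f.
- by move=> x y z t h g f; case: t / h.
Defined.

Definition idgroupoid : groupoid.
Proof.
refine (@Groupoid idgroupoid_cat _).
by move=> x y f; exists (esym f); case: y / f.
Defined.

End IdGroupoid.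

(** Bundling the endpoints makes equality of morphisms with a priori different
    endpoints meaningful. *)
Definition arrow (C : category) : Type := {x : C & {y : C & hom x y}}.

Definition Arrow (C : category) (x y : C) (f : hom x y) : arrow C :=
  existT _ x (existT _ y f).

Definition source (C : category) (m : arrow C) : C := projT1 m.

Definition arrow_map (C D : category) (F : functor C D) (m : arrow C) :
  arrow D := Arrow (fmor F (projT2 (projT2 m))).

Definition covering (A B : category) (pi : functor A B) : Prop :=
  forall (y1 y2 : B) (f : hom y1 y2) (x1 : A), pi x1 = y1 ->
    exists! m : arrow A, source m = x1 /\ arrow_map pi m = Arrow f.

Definition finite_fibres (A B : category) (pi : functor A B) : Prop :=
  forall y : B, finite_set [set x : A | pi x = y].

(** The number of elements of a finite set in an arbitrary type (by the
    conventions of [fset_set], 0 if the set is infinite). *)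
Definition ncard (T : Type) (S : set T) : nat :=
  #|` fset_set (S : set {classic T})|%fset.

Definition degree_at (A B : category) (pi : functor A B) (y : B) : nat :=
  ncard [set x : A | pi x = y].

Definition homogeneous_covering (A B : category) (pi : functor A B) (d : nat) :
    Prop :=
  [/\ covering pi, finite_fibres pi & forall y : B, degree_at pi y = d].

Section Coarse.
Variable C : category.

Definition iso_rel : rel {classic C} := fun x y => `[< @isomorphic C x y >].

Let iso_refl : reflexive iso_rel.
Proof.
move=> x; apply/asboolP; exists (idm (x : C)), (idm (x : C)).
by rewrite !compm_idl.
Qed.

Let iso_sym : symmetric iso_rel.
Proof.
by move=> x y; apply/asboolP/asboolP => -[f [g [gf fg]]]; exists g, f.
Qed.

Let iso_trans : transitive iso_rel.
Proof.
move=> y x z /asboolP[f [g [gf fg]]] /asboolP[h [k [kh hk]]].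
apply/asboolP; exists (compm h f), (compm g k); split.
- by rewrite compmA -(compmA g) kh compm_idr gf.
- by rewrite compmA -(compmA h) fg compm_idr hk.
Qed.

Canonical iso_equiv := EquivRel iso_rel iso_refl iso_sym iso_trans.

Definition coarse := {eq_quot iso_equiv}.

HB.instance Definition _ := Choice.on coarse.
HB.instance Definition _ := Quotient.on coarse.

Definition class_of (x : C) : coarse := \pi_coarse (x : {classic C}).

Definition class_repr (c : coarse) : C := repr c.

End Coarse.

Definition finite_homs (A : groupoid) : Prop :=
  forall x : A, finite_set [set: hom x x].

(** A decomposition of [A] as a coproduct of groupoids [A_n], [n : nat], with
    finitely many isomorphism classes each, is recorded by the index of the
    summand containing each object. *)
Record grading (A : groupoid) := Grading {
  gr :> A -> nat;
  gr_iso : forall x y : A, isomorphic x y -> gr x = gr y;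
  gr_finite : forall n,
    finite_set [set class_of x | x in [set x : A | gr x = n]]
}.

Definition coarse_in (A : groupoid) (g : grading A) (n : nat) :
  set (coarse A) := [set class_of x | x in [set x : A | g x = n]].

Definition discrete_measure (K : realType) (A : groupoid) (c : coarse A) :
  K[i] := 1 / (ncard [set: hom (class_repr c) (class_repr c)])%:R.

HB.mixin Record TopologicalZmodule_isTopologicalRing R
    & Topological R & GRing.PzRing R := {
  mul_continuous : continuous (fun z : R * R => z.1 * z.2)
}.

#[short(type="topComRingType")]
HB.structure Definition TopComRing :=
  {R of TopologicalZmodule R & GRing.ComPzRing R
      & TopologicalZmodule_isTopologicalRing R}.

(** The library joins the topological and module structures over a
    [numDomainType] only, and a new join over an arbitrary ring would conflict
    with these. Topological modules over a topological ring are therefore a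
    record, whose carrier is then given the topology and module structures of
    the library. *)
Record topModule (R : topComRingType) := TopModule {
  topmod_zmod : topologicalZmodType;
  topmod_lmod : GRing.Zmodule_isLmodule R topmod_zmod;
  topmod_continuous : continuous (fun z : R * topmod_zmod =>
    GRing.Zmodule_isLmodule.scale topmod_lmod z.1 z.2)
}.

Definition topmod_sort (R : topComRingType) (V : topModule R) : Type :=
  topmod_zmod V.
Coercion topmod_sort : topModule >-> Sortclass.

HB.instance Definition _ (R : topComRingType) (V : topModule R) :=
  TopologicalZmodule.on (topmod_sort V).
HB.instance Definition _ (R : topComRingType) (V : topModule R) :
  GRing.Zmodule_isLmodule R (topmod_sort V) := topmod_lmod V.

(** A commutative unital [K[i]]-algebra structure on [R] is given by its
    structure morphism [iota]; [K[i]] carries no topology. *)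
Section Integral.
Variables (K : realType) (R : topComRingType) (iota : {rmorphism K[i] -> R}).
Variables (V : topModule R).
Variables (A : groupoid) (g : grading A) (phi : functor A (idgroupoid V)).

Definition integral_term (n : nat) : V :=
  \sum_(c \in coarse_in g n)
    iota (discrete_measure K c) *: (phi (class_repr c) : V).

Definition is_integral (v : V) : Prop := series integral_term @ \oo --> v.

Definition integrable_morphism : Prop := exists v : V, is_integral v.

(** The sum of the series (the library's [lim] does not apply since [V] is not
    a pointed type). It is determined when [V] is Hausdorff; the value is 0 for
    a divergent series. *)
Definition groupoid_integral : V := xget 0 [set v : V | is_integral v].

End Integral.

Arguments is_integral {K R} iota {V A} g phi v.
Arguments integrable_morphism {K R} iota {V A} g phi.
Arguments groupoid_integral {K R} iota {V A} g phi.

(* Main.v *)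
Require Import Defs.
From HB Require Import structures.
From mathcomp Require Import all_boot all_order all_algebra.
From mathcomp Require Import generic_quotient finmap.
From mathcomp Require Import complex.
From mathcomp Require Import all_classical all_reals all_analysis.
Local Open Scope classical_set_scope.
Local Open Scope ring_scope.
Import GRing.Theory Num.Theory.

(** Up to the factor [d], the two integrals are two evaluations of one and the
    same sum, degree by degree of the grading. Fix [n] and choose a
    representative of each isomorphism class of [B] of degree [n]; let [S] be
    the finite set of the objects of [A] lying over these representatives. Give
    the object [x] of [S] the weight [phi (pi x) / |Aut (pi x)|] and sum over
    [S] in two ways.

    - Along [x |-> pi x]: the weight depends on [pi x] only, and every fibre
      has [d] elements, so the sum is [d] times the [n]-th term for [B].

    - Along [x |-> [x]]: unique lifting of morphisms makes [Aut (pi x)] permute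
      the fibre of [pi] through [x], with the isomorphism class of [x] in this
      fibre as orbit and [Aut x] as stabilizer. So [|Aut (pi x)|] is [|Aut x|]
      times the number of elements of [S] in the class of [x]
      ([orbit_stabilizer]), and the weights of these add up to
      [phi (pi x) / |Aut x|] ([discrete_measure_fibre]). The sum is the [n]-th
      term for [A].

    Hence the [n]-th terms differ by the factor [d]
    ([integral_term_pullback]), and so do the partial sums of the two series.
    The scalar multiplication of [V] being continuous, convergence to [v] for
    [B] implies convergence to [d v] for [A]; when [V] is Hausdorff, the sums
    of the series are these limits. *)

(* Morphisms of a category, as opposed to linear maps. *)
Local Notation hom := Defs.hom.

(** * Cardinality and sums over finite sets *)

Lemma eq_ncard {T U : Type} (S : set T) (S' : set U) :
  (S #= S')%card -> ncard S = ncard S'.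
Proof.
move=> SS'; rewrite /ncard.
have [/finite_setP[n S'n]|S'inf] := pselect (finite_set S').
  have Sn := card_eq_trans SS' S'n.
  by rewrite (@card_fset_set {classic T} S n Sn) (@card_fset_set {classic U} S' n).
(* Both cardinals are then 0 by convention. *)
have Sinf : ~ finite_set S by rewrite (eq_finite_set SS').
by rewrite /fset_set; case: pselect => // _; case: pselect.
Qed.

Lemma ncard_image {T U : Type} (f : T -> U) (S : set T) :
  {in S &, injective f} -> ncard (f @` S) = ncard S.
Proof. by move=> /inj_card_eq /eq_ncard. Qed.

Lemma fsum_const {T : choiceType} {M : nmodType} (S : set T) (v : M) :
  finite_set S -> \sum_(x \in S) v = v *+ ncard S.
Proof.
move=> Sfin; rewrite fsbig_finite// big_const_seq count_predT iter_addr_0.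
case/finite_setP: (Sfin) => n Sn.
by rewrite /ncard (@card_fset_set T S n Sn) (@card_fset_set {classic T} S n Sn).
Qed.

Lemma ncardE {T : Type} (S : set {classic T}) : finite_set S ->
  ncard S = \sum_(x \in S) 1%N.
Proof. by move=> Sfin; rewrite fsum_const// -[RHS]mulr_natr mul1r natn. Qed.

Lemma ncard_gt0 {T : Type} (S : set T) (x : T) : finite_set S -> S x ->
  (0 < ncard S)%N.
Proof.
move=> Sfin Sx; rewrite /ncard lt0n; apply/eqP => /cardfs0_eq S0.
have : (x : {classic T}) \in fset_set (S : set {classic T}).
  by rewrite in_fset_set//; exact: mem_set.
by rewrite S0.
Qed.

(** Both sides are the sum over [S `*` C] of [F] supported on the graph of [f];
    the order of summation is exchanged. *)
Lemma fsum_fibres {I J : choiceType} {M : nmodType} (f : I -> J) (S : set I)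
    (C : set J) (F : I -> M) : finite_set S -> finite_set C ->
    (forall i, S i -> C (f i)) ->
  \sum_(i \in S) F i = \sum_(j \in C) \sum_(i \in S `&` f @^-1` [set j]) F i.
Proof.
move=> Sfin Cfin fSC.
under [RHS]eq_fsbigr do rewrite fsbig_mkcondr.
rewrite exchange_fsbig//; apply: eq_fsbigr => i; rewrite inE => Si.
rewrite (fsbigD1 (f i))//=; last exact: fSC.
rewrite ifT ?inE// fsbig1 ?addr0// => j [_ /= jNfi].
by rewrite ifF//; apply/negP; rewrite inE => fij; apply: jNfi.
Qed.

(** * Categories, groupoids and their isomorphism classes *)

(** Equality of dependent pairs gives equality of the second components because
    objects have decidable equality, hence unique identity proofs, in
    [{classic C}]. *)
Lemma Arrow_inj {C : category} (x y : C) : injective (@Arrow C x y).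
Proof.
move=> f f' /(@eq_from_Tagged {classic C} (fun x => {y : C & hom x y})).
exact: (@eq_from_Tagged {classic C} (fun y => hom x y)).
Qed.

Definition target {C : category} (m : arrow C) : C := projT1 (projT2 m).

(** Passes from an arrow whose endpoints are known propositionally to a morphism
    between these endpoints, without transporting along equalities. *)
Lemma arrowE {C : category} (x y : C) (m : arrow C) :
  source m = x -> target m = y -> exists f : hom x y, m = Arrow f.
Proof. by case: m => x' [y' f] /= <- <-; exists f. Qed.

Lemma isomorphic_sym {C : category} (x y : C) :
  isomorphic x y -> isomorphic y x.
Proof. by move=> [f [g [gf fg]]]; exists g, f. Qed.

Lemma class_ofP {C : category} (x y : C) :
  class_of x = class_of y <-> isomorphic x y.
Proof.
split=> [/eqmodP/asboolP//|xy].
by apply/eqmodP/asboolP.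
Qed.

Lemma class_reprK {C : category} (c : coarse C) : class_of (class_repr c) = c.
Proof. exact: reprK. Qed.

Lemma isomorphic_class_repr {C : category} (x : C) :
  isomorphic (class_repr (class_of x)) x.
Proof. by apply/class_ofP; rewrite class_reprK. Qed.

Lemma functor_isomorphic {C D : category} (F : functor C D) (x y : C) :
  isomorphic x y -> isomorphic (F x) (F y).
Proof.
move=> [f [g [gf fg]]]; exists (fmor F f), (fmor F g).
by rewrite -!fmor_comp gf fg !fmor_id.
Qed.

Lemma ncard_hom_isomorphic {C : category} (z x y : C) : isomorphic x y ->
  ncard [set: hom z x] = ncard [set: hom z y].
Proof.
move=> [f [g [gf fg]]]; rewrite -(@ncard_image _ _ (compm f)).
  congr ncard; apply/seteqP; split=> // h _ /=.
  by exists (compm g h) => //; rewrite compmA fg compm_idl.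
move=> h h' _ _ /(congr1 (compm g)).
by rewrite !compmA gf !compm_idl.
Qed.

Lemma ncard_aut_isomorphic {C : category} (x y : C) : isomorphic x y ->
  ncard [set: hom x x] = ncard [set: hom y y].
Proof.
move=> xy; rewrite (ncard_hom_isomorphic x x y xy).
case: xy => [f [g [gf fg]]]; rewrite -(@ncard_image _ _ (fun h : hom x y => compm h g)).
  congr ncard; apply/seteqP; split=> // h _ /=.
  by exists (compm h f) => //; rewrite -compmA fg compm_idr.
move=> h h' _ _ /(congr1 (fun h => compm h f)).
by rewrite -!compmA gf !compm_idr.
Qed.

Lemma finite_hom {A : groupoid} (x y : A) :
  finite_homs A -> finite_set [set: hom x y].
Proof.
move=> finA; have [[f _]|noxy] := pselect (isomorphic x y).
  have [g [gf fg]] := gpd_iso f.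
  rewrite (_ : [set: _] = compm f @` [set: hom x x]).
    exact/finite_image/finA.
  apply/seteqP; split=> // h _ /=.
  by exists (compm g h) => //; rewrite compmA fg compm_idl.
rewrite (_ : [set: _] = set0)//; apply/seteqP; split=> // f _.
by apply: noxy; exists f; exact: gpd_iso.
Qed.

(** * Coverings of groupoids *)

Lemma covering_lift_object {A : groupoid} {B : category} (pi : functor A B)
    (x : A) (y : B) : covering pi -> isomorphic (pi x) y ->
  exists2 x', isomorphic x x' & pi x' = y.
Proof.
move=> cov [f _]; have [m [[mx mf] _]] := cov _ _ f x erefl.
exists (target m); last exact: (congr1 target mf).
by have [h _] := arrowE x (target m) m mx erefl; exists h; exact: gpd_iso.
Qed.

(** The set [L] of the morphisms of [A] that start at [x] and end in the fibre
    through [x] is counted twice. Unique lifting identifies it with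
    [Aut (pi x)]. Sorted by target, it is the disjoint union of the [hom x x'],
    [x'] running over the objects of the fibre isomorphic to [x], and each of
    these is a torsor under [Aut x]. *)
Lemma orbit_stabilizer {A B : groupoid} (pi : functor A B) (x : A) :
    finite_homs A -> covering pi -> finite_fibres pi ->
  ncard [set: hom (pi x) (pi x)] =
  (ncard [set: hom x x] *
   ncard [set x' : A | pi x' = pi x /\ isomorphic x x'])%N.
Proof.
move=> finA cov finpi.
set L := [set m : arrow A | source m = x /\ pi (target m) = pi x].
set O := [set x' : A | _].
have Ofin : finite_set O by apply: sub_finite_set (finpi (pi x)) => x' [].
have LE : L = \bigcup_(x' in O) (@Arrow A x x' @` [set: hom x x']).
  apply/seteqP; split=> [m [mx my]|m [x' [x'y _] [f _ <-]]]; last by split.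
  have [f ->] := arrowE x (target m) m mx erefl.
  by exists (target m); [split=> //; exists f; exact: gpd_iso|exists f].
have Lfin : finite_set L.
  rewrite LE; apply: bigcup_finite => // x' _.
  exact/finite_image/finite_hom.
transitivity (ncard L).
  (* [pi] maps [L] bijectively onto the endomorphisms of [pi x]. *)
  rewrite -(ncard_image (@Arrow B (pi x) (pi x))); last first.
    by move=> f f' _ _; exact: Arrow_inj.
  rewrite -(@ncard_image _ _ (arrow_map pi) L).
    congr ncard; apply/seteqP; split=> [_ [f _ <-]|_ [m [mx my] <-]].
      have [m [[mx mf] _]] := cov _ _ f x erefl; exists m => //; split=> //.
      exact: (congr1 target mf).
    have [f ->] := arrowE (pi x) (pi x) (arrow_map pi m) (congr1 pi mx) my.
    by exists f.
  move=> m m'; rewrite !inE => -[mx my] [m'x m'y] mm'.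
  have [f mf] := arrowE (pi x) (pi x) (arrow_map pi m) (congr1 pi mx) my.
  have [m0 [_ m0u]] := cov _ _ f x erefl.
  by rewrite -(m0u m)// -(m0u m')//; split=> //; rewrite -mm'.
rewrite (ncardE L)//
  (fsum_fibres (@target A : {classic arrow A} -> {classic A}) L O)//; last first.
  move=> m [mx my]; split=> //; case: m mx my => a [b f] /= ax _.
  by subst a; exists f; exact: gpd_iso.
transitivity (\sum_(x' \in (O : set {classic A})) ncard [set: hom x x]);
  last first.
  by rewrite (@fsum_const {classic A})// -[LHS]mulr_natr natn.
apply: eq_fsbigr => x'; rewrite inE => -[x'y xx'].
rewrite -ncardE; last exact: finite_setIl.
rewrite (ncard_hom_isomorphic x x x' xx').
rewrite -(ncard_image (@Arrow A x x')); last by move=> f f' _ _; exact: Arrow_inj.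
congr ncard; apply/seteqP; split=> [m [[mx my] mx']|m [f _ <-]]; last by [].
by have [f ->] := arrowE x x' m mx mx'; exists f.
Qed.

(** * Comparison of the two integrals *)

Lemma finite_coarse_in {A : groupoid} (g : grading A) (n : nat) :
  finite_set (coarse_in g n).
Proof. exact: gr_finite. Qed.

Lemma gr_class_repr {A : groupoid} (g : grading A) (n : nat) (c : coarse A) :
  coarse_in g n c -> g (class_repr c) = n.
Proof. by move=> [x <- <-]; apply/gr_iso/isomorphic_class_repr. Qed.

Lemma discrete_measure_class_of {K : realType} {A : groupoid} (x : A) :
  discrete_measure K (class_of x) = (ncard [set: hom x x])%:R^-1.
Proof.
by rewrite /discrete_measure div1r
  (ncard_aut_isomorphic _ _ (isomorphic_class_repr x)).
Qed.

(** The morphisms of [idgroupoid T] are equality proofs, so that [fmor phi] is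
    the required equality. *)
Lemma functor_idgroupoid {A : groupoid} {T : Type}
    (phi : functor A (idgroupoid T)) (x y : A) :
  isomorphic x y -> phi x = phi y.
Proof. by move=> [f _]; exact: fmor phi x y f. Qed.

Section Pullback.
Context {K : realType} {R : topComRingType} (iota : {rmorphism K[i] -> R}).
Context {V : topModule R} {A B : groupoid} (pi : functor A B) (d : nat).
Hypotheses (finA : finite_homs A) (pi_hom : homogeneous_covering pi d).

(** Objects over the chosen representatives only, rather than over all objects
    of the classes in [C]: this is what makes the set finite. *)
Definition over_repr (C : set (coarse B)) : set {classic A} :=
  [set x | exists2 c, C c & pi x = class_repr c].

Lemma finite_over_repr (C : set (coarse B)) :
  finite_set C -> finite_set (over_repr C).
Proof.
move=> Cfin; case: pi_hom => _ finpi _.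
apply: sub_finite_set (bigcup_finite Cfin (fun c _ => finpi (class_repr c))).
by move=> x [c Cc xc]; exists c.
Qed.

(** The class of [x] cut out by [over_repr C] is its class within the fibre of
    [pi] through [x]: two isomorphic objects over representatives lie over
    isomorphic, hence equal, representatives. So [orbit_stabilizer] gives its
    cardinal. *)
Lemma discrete_measure_fibre (C : set (coarse B)) (x : A) :
    over_repr C x -> finite_set C ->
  discrete_measure K (class_of (pi x)) *+
    ncard (over_repr C `&` (@class_of A) @^-1` [set class_of x]) =
  discrete_measure K (class_of x).
Proof.
move=> Cx Cfin; case: (pi_hom) => cov finpi _.
have fib_gt0 : (0 < ncard (over_repr C `&`
    (@class_of A : {classic A} -> coarse A) @^-1` [set class_of x]))%N.
  by apply: (ncard_gt0 _ x) => //; exact/finite_setIl/finite_over_repr.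
rewrite !discrete_measure_class_of (orbit_stabilizer pi x)//.
suff -> : [set x' : A | pi x' = pi x /\ isomorphic x x'] =
    over_repr C `&` (@class_of A) @^-1` [set class_of x].
  rewrite natrM invfM -[LHS]mulr_natr mulfVK//.
  by rewrite pnatr_eq0 -lt0n.
case: Cx => c Cc xc; apply/seteqP; split=> x' /=.
  by move=> [x'x xx']; split; [exists c => //; rewrite x'x|exact/esym/class_ofP].
move=> [[c' Cc' x'c'] /esym/class_ofP xx']; split=> //.
suff cc' : c = c' by rewrite x'c' xc cc'.
rewrite -(class_reprK c) -(class_reprK c') -xc -x'c'.
exact/class_ofP/functor_isomorphic.
Qed.

Lemma integral_term_pullback (gA : grading A) (gB : grading B)
    (phi : functor B (idgroupoid V)) (n : nat) :
    (forall x : A, gB (pi x) = gA x) ->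
  integral_term iota gA (fcomp phi pi) n = d%:R *: integral_term iota gB phi n.
Proof.
move=> pi_graded; case: (pi_hom) => cov finpi degpi.
have fA := finite_coarse_in gA n; have fB := finite_coarse_in gB n.
set S := over_repr (coarse_in gB n).
have Sfin : finite_set S by exact: finite_over_repr.
pose F (x : {classic A}) : V :=
  iota (discrete_measure K (class_of (pi x))) *: (phi (pi x) : V).
transitivity (\sum_(x \in S) F x).
  (* Sorting [S] by isomorphism classes of [A]. *)
  rewrite (fsum_fibres (@class_of A : {classic A} -> coarse A) S
    (coarse_in gA n))//; last first.
    move=> x [c Bc xc]; exists x => //=.
    by rewrite -pi_graded xc (gr_class_repr _ n).
  apply: eq_fsbigr => c; rewrite inE => Ac.
  (* The chosen representative of [c] need not lie in [S]; some object
     isomorphic to it does. *)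
  have [x cx pix] := covering_lift_object pi (class_repr c) _ cov
    (isomorphic_sym _ _ (isomorphic_class_repr _)).
  have xc : class_of x = c by rewrite -[RHS]class_reprK; apply/esym/class_ofP.
  have Sx : S x.
    exists (class_of (pi (class_repr c))) => //.
    by exists (pi (class_repr c)) => //=; rewrite pi_graded (gr_class_repr _ n).
  rewrite -{}xc in cx Ac pix *.
  rewrite -(discrete_measure_fibre _ x Sx fB) rmorphMn/= -scalerMnl.
  rewrite -fsum_const//; last exact: finite_setIl.
  apply: eq_fsbigr => x'; rewrite inE => -[_ /= /class_ofP x'x].
  have pix'x := functor_isomorphic pi _ _ x'x.
  rewrite /F (proj2 (class_ofP _ _) pix'x) (functor_idgroupoid phi _ _ pix'x).
  congr (_ *: _); apply/functor_idgroupoid/functor_isomorphic.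
  exact: isomorphic_class_repr.
(* Sorting [S] by isomorphism classes of [B], that is, by fibres of [pi]. *)
rewrite (fsum_fibres (fun x : {classic A} => class_of (pi x)) S
  (coarse_in gB n))//; last first.
  by move=> x [c Bc xc]; rewrite xc class_reprK.
rewrite /integral_term !fsbig_finite// scaler_sumr; apply: eq_big_seq => c.
rewrite in_fset_set// inE => Bc.
rewrite scaler_nat -(degpi (class_repr c)) /degree_at -(@fsum_const {classic A})//.
rewrite (_ : _ `&` _ = [set x : {classic A} | pi x = class_repr c]).
  apply: eq_fsbigr => x; rewrite inE => /= xc.
  by rewrite /F xc class_reprK.
apply/seteqP; split=> x /=.
  by move=> [[c' Bc' xc'] <-]; rewrite xc' class_reprK.
by move=> xc; split; [exists c|rewrite xc class_reprK].
Qed.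

Lemma is_integral_pullback (gA : grading A) (gB : grading B)
    (phi : functor B (idgroupoid V)) (v : V) :
    (forall x : A, gB (pi x) = gA x) -> is_integral iota gB phi v ->
  is_integral iota gA (fcomp phi pi) (d%:R *: v).
Proof.
move=> pi_graded phiv; rewrite /is_integral.
rewrite (_ : series _ = fun n => d%:R *: series (integral_term iota gB phi) n);
  last first.
  apply/funext => n; rewrite /series/= scaler_sumr.
  by apply: eq_bigr => k _; exact: integral_term_pullback.
apply: (@continuous2_cvg _ _ _ _ _ _ (fun=> d%:R) _
  (fun (a : R) (w : V) => a *: w)) => //.
- exact: (@topmod_continuous R V (d%:R, v)).
- exact: cvg_cst.
Qed.

End Pullback.

Theorem proposition3p1 (K : realType) (R : topComRingType)
    (iota : {rmorphism K[i] -> R}) (V : topModule R)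
    (A B : groupoid) (finA : finite_homs A) (finB : finite_homs B)
    (gA : grading A) (gB : grading B)
    (pi : functor A B) (pi_graded : forall x : A, gB (pi x) = gA x)
    (d : nat) (pi_homogeneous : homogeneous_covering pi d)
    (phi : functor B (idgroupoid V)) (phi_int : integrable_morphism iota gB phi) :
  [/\ integrable_morphism iota gA (fcomp phi pi),
      forall v : V, is_integral iota gB phi v ->
        is_integral iota gA (fcomp phi pi) (d%:R *: v)
    & hausdorff_space V ->
        groupoid_integral iota gA (fcomp phi pi) =
          d%:R *: groupoid_integral iota gB phi].
Proof.
have pullback v : is_integral iota gB phi v ->
    is_integral iota gA (fcomp phi pi) (d%:R *: v).
  exact: is_integral_pullback.
split=> //; case: phi_int => v phiv.
  by exists (d%:R *: v); exact: pullback.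
move=> hausV.
have integralE (C : groupoid) (g : grading C) (psi : functor C (idgroupoid V)) w :
    is_integral iota g psi w -> groupoid_integral iota g psi = w.
  by move=> psiw; apply: xget_subset1 => //; exact: cvg_unique.
by rewrite (integralE _ _ _ _ (pullback v phiv)) (integralE _ _ _ _ phiv).
Qed.
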